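(* Let $R$ be a finite commutative ring with identity of odd characteristic and let $m$ be a positive integer. Then $\mathfrak{sp}_{2^{m+1}}(R)$ has an ODAC obtained by restricting the ODAC $\mathfrak{sl}_{2^{m+1}}(R)=H_\infty\oplus\bigoplus_{\alpha\in\mathbb{F}_{2^{m+1}}}H_\alpha$ described in the context; that is, putting $$H'_\alpha=\langle \mathcal{J}_{(\lambda;\alpha\lambda)} : \lambda\in\mathbb{F}_{2^{m+1}}^\times,\ (\lambda;\alpha\lambda)\in Q\rangle_R\quad(\alpha\in\mathbb{F}_{2^{m+1}}),$$ $$H'_\infty=\langle \mathcal{J}_{(0;\lambda)} : \lambda\in\mathbb{F}_{2^{m+1}}^\times,\ (0;\lambda)\in Q\rangle_R,$$ the decomposition $$\mathfrak{sp}_{2^{m+1}}(R)=H'_\infty\oplus\bigoplus_{\alpha\in\mathbb{F}_{2^{m+1}}}H'_\alpha$$ is an ODAC of $\mathfrak{sp}_{2^{m+1}}(R)$.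
   Context: ODAC: let $L$ be a Lie algebra over $R$ that is free of finite rank as an $R$-module. A Cartan subalgebra of $L$ is a nilpotent subalgebra $H$ that equals its normalizer $N_L(H)=\{x\in L:[x,H]\subseteq H\}$. The Killing form is $K(A,B)=\operatorname{Tr}(\operatorname{ad}A\cdot\operatorname{ad}B)$. An ODAC of $L$ is a direct sum decomposition of $R$-modules of $L$ into finitely many abelian Cartan subalgebras that are pairwise orthogonal with respect to the Killing form. Lie algebras: $\mathfrak{sl}_N(R)$ is the Lie algebra of trace-zero $N\times N$ matrices, and $\mathfrak{sp}_{2^{m+1}}(R)=\{X\in M_{2^{m+1}}(R): XK+KX^T=0\}$ with $K=\begin{pmatrix}0&I_{2^m}\\-I_{2^m}&0\end{pmatrix}$, both with bracket $[A,B]=AB-BA$. The space $W$: $W=\mathbb{F}_{2^{m+1}}\oplus\mathbb{F}_{2^{m+1}}$ is regarded as a $2(m+1)$-dimensional $\mathbb{F}_2$-vector space, with elements written $(\alpha;\beta)$, and with symplectic form $\langle(\alpha;\beta),(\alpha';\beta')\rangle=\operatorname{Tr}_{\mathbb{F}_{2^{m+1}}/\mathbb{F}_2}(\alpha\beta'-\alpha'\beta)$. Fix a symplectic basis $\{\vec e_1,\dots,\vec e_{m+1},\vec f_1,\dots,\vec f_{m+1}\}$ of $W$ over $\mathbb{F}_2$ such that the $\vec e_i$ span the first factor, the $\vec f_i$ span the second factor, and $\langle\vec w,\vec w'\rangle=\sum_{i=1}^{m+1}(a_ib'_i-a'_ib_i)$ for $\vec w=\sum_i(a_i\vec e_i+b_i\vec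 f_i)$, $\vec w'=\sum_i(a'_i\vec e_i+b'_i\vec f_i)$. In these coordinates write $\vec w=(a_1,\dots,a_{m+1};b_1,\dots,b_{m+1})$ with $a_i,b_i\in\mathbb{F}_2=\{0,1\}$. Matrices: with $D=\begin{pmatrix}1&0\\0&-1\end{pmatrix}$, $P=\begin{pmatrix}0&1\\1&0\end{pmatrix}$ over $R$, put $J_{(a,b)}=D^aP^b$ and $\mathcal{J}_{\vec w}=J_{(a_1,b_1)}\otimes J_{(a_2,b_2)}\otimes\cdots\otimes J_{(a_{m+1},b_{m+1})}$ (Kronecker product). Quadratic form: $q(\vec w)=\sum_{i=1}^{m+1}a_ib_i+(a_1+b_1)\in\mathbb{F}_2$ and $Q=\{\vec w\in W: q(\vec w)=1\}$. The known ODAC of $\mathfrak{sl}_{2^{m+1}}(R)$ has components $H_\infty=\langle\mathcal{J}_{(0;\lambda)}:\lambda\in\mathbb{F}_{2^{m+1}}^\times\rangle_R$ and $H_\alpha=\langle\mathcal{J}_{(\lambda;\alpha\lambda)}:\lambda\in\mathbb{F}_{2^{m+1}}^\times\rangle_R$ for $\alpha\in\mathbb{F}_{2^{m+1}}$. Here $\langle\cdot\rangle_R$ denotes $R$-span. *)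

(* Defs.v *)
From HB Require Import structures.
From mathcomp Require Import all_boot all_order all_fingroup all_algebra.
From mathcomp Require Import all_solvable all_field.
From mathcomp Require Import mxtens.
From mathcomp Require Import ring.

Set Implicit Arguments.
Unset Strict Implicit.
Unset Printing Implicit Defensive.

Import GRing.Theory VectorInternalTheory.
Local Open Scope ring_scope.

(* A [vectType R] over a ring [R] is an [R]-module with a linear bijection to
   some ['rV[R]_n], i.e. a free module of finite rank. *)
HB.mixin Record hasLieBracket (R : comNzRingType) L of Vector R L := {
  lie : L -> L -> L;
  lieDl : forall (a : R) (x y z : L),
    lie (a *: x + y) z = a *: lie x z + lie y z;
  lieDr : forall (a : R) (x y z : L),
    lie z (a *: x + y) = a *: lie z x + lie z y;
  liexx : forall x : L, lie x x = 0;
  lie_jacobi : forall x y z : L,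
    lie x (lie y z) + lie y (lie z x) + lie z (lie x y) = 0
}.

#[short(type="lieVectType")]
HB.structure Definition LieVector (R : comNzRingType) :=
  {L of Vector R L & hasLieBracket R L}.

(* Trace of an endomorphism of a free module of finite rank; [f2mx] is its
   matrix in the basis that comes with the [vectType] structure. *)
Definition lin_trace (R : comNzRingType) (V : vectType R) (f : V -> V) : R :=
  \tr (f2mx (linfun f)).

Definition lspan (R : comNzRingType) (V : lmodType R) (S : V -> Prop) : V -> Prop :=
  fun x => exists (n : nat) (c : 'I_n -> R) (v : 'I_n -> V),
    (forall i, S (v i)) /\ x = \sum_i c i *: v i.

Definition is_submodule (R : comNzRingType) (V : lmodType R) (H : V -> Prop) : Prop :=
  H 0 /\ (forall (a : R) x y, H x -> H y -> H (a *: x + y)).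

Section LieTheory.

Variables (R : comNzRingType) (L : lieVectType R).
Implicit Types H : L -> Prop.

Definition ad (x : L) : L -> L := lie x.

Definition killing (x y : L) : R := lin_trace (ad x \o ad y).

Definition is_subalgebra H : Prop :=
  is_submodule H /\ (forall x y, H x -> H y -> H (lie x y)).

Definition is_abelian H : Prop := forall x y, H x -> H y -> lie x y = 0.

Fixpoint lower_central H (k : nat) : L -> Prop :=
  if k is k'.+1 then
    lspan (fun z => exists x y, H x /\ lower_central H k' y /\ z = lie x y)
  else H.

Definition is_nilpotent H : Prop :=
  exists k, forall x, lower_central H k x -> x = 0.

Definition normalizer H : L -> Prop := fun x => forall y, H y -> H (lie x y).

Definition is_cartan H : Prop :=
  [/\ is_subalgebra H, is_nilpotent H & forall x, H x <-> normalizer H x].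

Definition is_direct_sum (I : finType) (H : I -> L -> Prop) : Prop :=
  (forall i, is_submodule (H i)) /\
  (forall x, exists! y : {ffun I -> L},
     (forall i, H i (y i)) /\ x = \sum_i y i).

Definition is_ODAC (I : finType) (H : I -> L -> Prop) : Prop :=
  [/\ is_direct_sum H,
      forall i, is_cartan (H i) /\ is_abelian (H i)
    & forall i j, i != j -> forall x y, H i x -> H j y -> killing x y = 0].

End LieTheory.

Section Symplectic.

Variables (R : comNzRingType) (n : nat).
Local Notation M := 'M[R]_(n + n).

Definition symplK : M := block_mx 0 1%:M (- 1%:M) 0.

Definition sp_pred : {pred M} := fun X => X *m symplK + symplK *m X^T == 0.

Lemma sp_predE X : (X \in sp_pred) = (X *m symplK + symplK *m X^T == 0).
Proof. by []. Qed.

Lemma sp_submod_closed : submod_closed sp_pred.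
Proof.
split=> [|a X Y /eqP hX /eqP hY]; apply/eqP.
  by rewrite mul0mx trmx0 mulmx0 addr0.
rewrite linearP /= mulmxDl mulmxDr -scalemxAl -scalemxAr addrACA -scalerDr.
by rewrite hX hY scaler0 addr0.
Qed.

HB.instance Definition _ :=
  GRing.isSubmodClosed.Build R M sp_pred sp_submod_closed.

Record sp := Sp { sp_val :> M; sp_valP : sp_val \in sp_pred }.

HB.instance Definition _ := [isSub for sp_val].
HB.instance Definition _ := [Choice of sp by <:].
HB.instance Definition _ := [SubChoice_isSubLmodule of sp by <:].

(* [sp] is free of finite rank: [X \in sp] iff [X *m symplK] is symmetric, so
   the entries of [X *m symplK] on and above the diagonal are coordinates. *)
Definition sp_index : predArgType :=
  {ij : 'I_(n + n) * 'I_(n + n) | (ij.1 <= ij.2)%N}.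

Definition sp_coords (X : sp) : 'rV[R]_#|{: sp_index}| :=
  \row_k ((val X *m symplK) (val (enum_val k)).1 (val (enum_val k)).2).

Lemma symplKK : symplK *m symplK = - 1%:M.
Proof.
rewrite /symplK mulmx_block !mul0mx !mulmx0 mul1mx mulmx1 !addr0 !add0r.
by rewrite -[1%:M in RHS]/(1%:M : 'M_(n + n)) scalar_mx_block opp_block_mx !oppr0.
Qed.

Lemma tr_symplK : symplK^T = - symplK.
Proof.
rewrite /symplK tr_block_mx opp_block_mx !trmx0 !oppr0 linearN /= trmx1.
by rewrite opprK.
Qed.

Lemma sp_symP (X : M) : reflect ((X *m symplK)^T = X *m symplK) (X \in sp_pred).
Proof.
rewrite -topredE /= /sp_pred trmx_mul tr_symplK mulNmx.
by rewrite addr_eq0 eq_sym; apply: eqP.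
Qed.

Lemma sp_sort_proof (i j : 'I_(n + n)) :
  ((if i <= j then (i, j) else (j, i)).1 <=
   (if i <= j then (i, j) else (j, i)).2)%N.
Proof. by case: (leqP i j) => //= /ltnW. Qed.

Definition sp_sort (i j : 'I_(n + n)) : sp_index :=
  exist _ (if (i <= j)%N then (i, j) else (j, i)) (sp_sort_proof i j).

Lemma sp_sortC i j : sp_sort i j = sp_sort j i.
Proof.
apply: val_inj => /=; case: (ltngtP i j) => // /val_inj ->.
by [].
Qed.

Definition sp_of_coords_mx (r : 'rV[R]_#|{: sp_index}|) : M :=
  - (\matrix_(i, j) r 0 (enum_rank (sp_sort i j)) *m symplK).

Lemma sp_of_coords_mxK r :
  sp_of_coords_mx r *m symplK = \matrix_(i, j) r 0 (enum_rank (sp_sort i j)).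
Proof. by rewrite /sp_of_coords_mx mulNmx -mulmxA symplKK mulmxN mulmx1 opprK. Qed.

Lemma sp_of_coords_proof r : sp_of_coords_mx r \in sp_pred.
Proof.
apply/sp_symP; rewrite sp_of_coords_mxK.
by apply/matrixP => i j; rewrite !mxE sp_sortC.
Qed.

Lemma sp_vect_axiom : Vector.axiom #|{: sp_index}| sp.
Proof.
exists sp_coords => [a X Y|].
  apply/rowP => k; rewrite !mxE linearP /= big_distrr -big_split /=.
  by apply: eq_bigr => i _; rewrite !mxE mulrDl mulrA.
exists (fun r => Sp (sp_of_coords_proof r)) => [X|r].
  apply: val_inj; rewrite /= /sp_of_coords_mx.
  have -> : (\matrix_(i, j) sp_coords X 0 (enum_rank (sp_sort i j)))
            = val X *m symplK.
    apply/matrixP => i j; rewrite mxE mxE enum_rankK /=.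
    case: ifP => //= _; have /sp_symP sX := valP X.
    by rewrite -{1}sX [LHS]mxE.
  by rewrite -mulmxA symplKK mulmxN mulmx1 opprK.
apply/rowP => k; rewrite mxE /= sp_of_coords_mxK mxE.
congr (r 0 _); apply: (canLR enum_valK); apply: val_inj => /=.
by case: (enum_val k) => -[i j] /= ->.
Qed.

HB.instance Definition _ := Lmodule_hasFinDim.Build R sp sp_vect_axiom.

Definition mxcomm (A B : M) : M := A *m B - B *m A.

Lemma sp_comm_proof (X Y : sp) : mxcomm X Y \in sp_pred.
Proof.
have := valP X; rewrite sp_predE addr_eq0 => /eqP /= hX.
have := valP Y; rewrite sp_predE addr_eq0 => /eqP /= hY.
apply/eqP; rewrite /mxcomm linearB /= !trmx_mul mulmxBl mulmxBr.
have e (A B : M) : A *m symplK = - (symplK *m A^T) ->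
    B *m symplK = - (symplK *m B^T) ->
    symplK *m (B^T *m A^T) = B *m A *m symplK.
  move=> hA hB; rewrite -[B *m A *m _]mulmxA hA mulmxN [B *m (_ *m _)]mulmxA hB.
  by rewrite mulNmx opprK mulmxA.
rewrite (e _ _ hX hY) (e _ _ hY hX).
by rewrite addrC addrA subrK addrN.
Qed.

Definition sp_lie (X Y : sp) : sp := Sp (sp_comm_proof X Y).

Fact sp_lieDl (a : R) (X Y Z : sp) :
  sp_lie (a *: X + Y) Z = a *: sp_lie X Z + sp_lie Y Z.
Proof.
apply: val_inj; rewrite /= /mxcomm mulmxDl mulmxDr -scalemxAl -scalemxAr.
by rewrite opprD addrACA scalerBr.
Qed.

Fact sp_lieDr (a : R) (X Y Z : sp) :
  sp_lie Z (a *: X + Y) = a *: sp_lie Z X + sp_lie Z Y.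
Proof.
apply: val_inj; rewrite /= /mxcomm mulmxDl mulmxDr -scalemxAl -scalemxAr.
by rewrite opprD addrACA scalerBr.
Qed.

Fact sp_liexx (X : sp) : sp_lie X X = 0.
Proof. by apply: val_inj; rewrite /= /mxcomm subrr. Qed.

Fact sp_jacobi (X Y Z : sp) :
  sp_lie X (sp_lie Y Z) + sp_lie Y (sp_lie Z X) + sp_lie Z (sp_lie X Y) = 0.
Proof.
apply: val_inj; rewrite /= /mxcomm !mulmxBr !mulmxBl !mulmxA.
by apply/matrixP => i j; rewrite !mxE; ring.
Qed.

HB.instance Definition _ :=
  hasLieBracket.Build R sp sp_lieDl sp_lieDr sp_liexx sp_jacobi.

End Symplectic.

Arguments sp_pred : clear implicits.


(* [c] is the characteristic of [R], not necessarily prime, possibly 0. *)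
Definition has_char (R : nzRingType) (c : nat) : Prop :=
  forall k : nat, (k%:R == 0 :> R) = (c %| k)%N.

Section SymplecticSpace.

Variable F : fieldExtType 'F_2.
Local Notation W := (F * F)%type.

Definition field_trace (x : F) : 'F_2 := lin_trace (fun y : F => x * y).

Definition symp (w w' : W) : 'F_2 := field_trace (w.1 * w'.2 - w'.1 * w.2).

Variable d : nat.
Variables e f : d.-tuple W.

Definition is_symplectic_basis : Prop :=
  [/\ basis_of {:W} (e ++ f),
      forall w : W, (w \in <<e>>%VS) = (w.2 == 0),
      forall w : W, (w \in <<f>>%VS) = (w.1 == 0)
    & forall a b a' b' : 'I_d -> 'F_2,
        symp (\sum_i (a i *: tnth e i + b i *: tnth f i))
             (\sum_i (a' i *: tnth e i + b' i *: tnth f i))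
        = \sum_i (a i * b' i - a' i * b i)].

Definition coord_a (w : W) (i : 'I_d) : 'F_2 :=
  coord [tuple of e ++ f] (lshift d i) w.
Definition coord_b (w : W) (i : 'I_d) : 'F_2 :=
  coord [tuple of e ++ f] (rshift d i) w.

End SymplecticSpace.

Section KroneckerMatrices.

Variable R : comNzRingType.

Definition matD : 'M[R]_2 :=
  \matrix_(i, j) nth 0 (nth [::] [:: [:: 1; 0]; [:: 0; -1]] i) j.
Definition matP : 'M[R]_2 :=
  \matrix_(i, j) nth 0 (nth [::] [:: [:: 0; 1]; [:: 1; 0]] i) j.

Definition matJ2 (a b : 'F_2) : 'M[R]_2 := matD ^+ a *m matP ^+ b.

Fixpoint kron (d : nat) : ('I_d -> 'M[R]_2) -> 'M[R]_(2 ^ d) :=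
  match d with
  | 0 => fun _ => 1%:M
  | d'.+1 => fun A =>
      castmx (esym (expnS 2 d'), esym (expnS 2 d'))
        (A ord0 *t kron (fun i : 'I_d' => A (lift ord0 i)))
  end.

Lemma pow2_double (m : nat) : (2 ^ m.+1 = 2 ^ m + 2 ^ m)%N.
Proof. by rewrite expnS mul2n addnn. Qed.

Variables (F : fieldExtType 'F_2) (m : nat) (e f : m.+1.-tuple (F * F)).

(* Cast to the block size [2 ^ m + 2 ^ m] on which [symplK] is defined. *)
Definition calJ (w : F * F) : 'M[R]_(2 ^ m + 2 ^ m) :=
  castmx (pow2_double m, pow2_double m)
    (kron (fun i => matJ2 (coord_a e f w i) (coord_b e f w i))).

Definition qform (w : F * F) : 'F_2 :=
  \sum_(i < m.+1) coord_a e f w i * coord_b e f w i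
  + (coord_a e f w ord0 + coord_b e f w ord0).

Definition inQ (w : F * F) : Prop := qform w = 1.

(* The lines of [W] through 0, indexed by the slope; [None] is infinity. *)
Definition line_pt (alpha : option F) (lambda : F) : F * F :=
  if alpha is Some al then (lambda, al * lambda) else (0, lambda).

Definition H_sl (alpha : option F) : 'M[R]_(2 ^ m + 2 ^ m) -> Prop :=
  lspan (fun X => exists lambda : F,
    lambda != 0 /\ X = calJ (line_pt alpha lambda)).

Definition H_sp (alpha : option F) : 'M[R]_(2 ^ m + 2 ^ m) -> Prop :=
  lspan (fun X => exists lambda : F,
    [/\ lambda != 0, inQ (line_pt alpha lambda)
      & X = calJ (line_pt alpha lambda)]).

End KroneckerMatrices.

(* Main.v *)
From HB Require Import structures.
Require Import Defs.
From mathcomp Require Import all_boot all_order all_fingroup all_algebra.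
From mathcomp Require Import all_solvable all_field.
From mathcomp Require Import mxtens ring zify.

(* In the coordinates of [W], the matrices [calJ w] are orthogonal, symmetric or
   antisymmetric, and commute up to the sign [(-1)^<w, w'>]. Conjugation by some
   [calJ z] with [<z, w + w'> = 1] therefore negates [tr (calJ w *m (calJ w')^T)],
   and also [killing (calJ w) (calJ w')], for [w != w']; as 2 is invertible, both
   vanish. So the [calJ w] are independent, and, [R] being finite, counting shows
   that they form a basis of the matrix ring. The involution defining [sp] acts on
   [calJ w] by a sign given by [q w], so the [calJ w] with [q w = 1] form a basis
   of [sp], and these [w] are partitioned by the lines of [W].

   For self-normalization: a [w] off a line [l] pairs nontrivially with [l] since
   [l] is maximal isotropic, and [q] is linear on [l], and nonzero on it by
   a Gauss sum argument. Two nonzero linear forms over ['F_2] take the value 1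
   simultaneously, which gives [u] on [l] with [q u = <u, w> = 1]; conjugation by
   [calJ u] then kills the [w]-coordinate of any element of [sp] normalizing the
   component attached to [l]. *)

Set Implicit Arguments.
Unset Strict Implicit.
Unset Printing Implicit Defensive.

Import Order.TTheory Num.Theory GRing.Theory VectorInternalTheory.
Local Open Scope ring_scope.

(** * Signs attached to elements of ['F_2] *)

Lemma F2_cases (x : 'F_2) : x = 0 \/ x = 1.
Proof. by case: x => [[|[|]] //] i; [left | right]; apply: val_inj. Qed.

Lemma F2_neq0 (x : 'F_2) : (x != 0) = (x == 1).
Proof. by case: (F2_cases x) => ->. Qed.

(** A character of the additive group ['F_2]; the exponent is the representative 0 or 1 of [x]. *)
Definition sgF2 (R : pzRingType) (x : 'F_2) : R := (-1) ^+ x.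

Arguments sgF2 {R} x.

Section SignF2.

Variable R : pzRingType.
Implicit Types x y : 'F_2.

Lemma sgF2_0 : sgF2 0 = 1 :> R.
Proof. by []. Qed.

Lemma sgF2_1 : sgF2 1 = -1 :> R.
Proof. by []. Qed.

Lemma sgF2D x y : sgF2 (x + y) = sgF2 x * sgF2 y :> R.
Proof.
case: (F2_cases x) => ->; first by rewrite add0r sgF2_0 mul1r.
case: (F2_cases y) => ->; first by rewrite addr0 sgF2_0 mulr1.
by rewrite sgF2_1 mulrNN mulr1.
Qed.

Lemma sgF2K x : sgF2 x * sgF2 x = 1 :> R.
Proof. by rewrite -sgF2D; case: (F2_cases x) => ->. Qed.

End SignF2.

Lemma sgF2_sum (R : comPzRingType) (I : finType) (x : I -> 'F_2) :
  sgF2 (\sum_i x i) = \prod_i sgF2 (x i) :> R.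
Proof. exact: (big_morph _ (@sgF2D R) (@sgF2_0 R)). Qed.

(** * Kronecker products of two-by-two matrices *)

Section Kronecker.

Variable R : comNzRingType.

Lemma castmx_sqM n n' (eqn : n = n') (A B : 'M[R]_n) :
  castmx (eqn, eqn) (A *m B) = castmx (eqn, eqn) A *m castmx (eqn, eqn) B.
Proof. by case: _ / eqn. Qed.

Lemma castmx_sq1 n n' (eqn : n = n') :
  castmx (eqn, eqn) (1%:M : 'M[R]_n) = 1%:M.
Proof. by case: _ / eqn. Qed.

Lemma castmx_sqZ n n' (eqn : n = n') a (A : 'M[R]_n) :
  castmx (eqn, eqn) (a *: A) = a *: castmx (eqn, eqn) A.
Proof. by case: _ / eqn. Qed.

Lemma eq_kron d (A B : 'I_d -> 'M[R]_2) : A =1 B -> kron A = kron B.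
Proof.
elim: d A B => //= d IHd A B eqAB; rewrite eqAB.
by congr (castmx _ (_ *t _)); apply: IHd => i.
Qed.

Lemma kronM d (A B : 'I_d -> 'M[R]_2) :
  kron A *m kron B = kron (fun i => A i *m B i).
Proof.
elim: d A B => [|d IHd] A B /=; first by rewrite mulmx1.
by rewrite -castmx_sqM tensmx_mul IHd.
Qed.

Lemma tr_kron d (A : 'I_d -> 'M[R]_2) : (kron A)^T = kron (fun i => (A i)^T).
Proof.
elim: d A => [|d IHd] A /=; first by rewrite trmx1.
by rewrite trmx_cast /= trmx_tens IHd.
Qed.

Lemma tensmx1 n p : (1%:M : 'M[R]_n) *t (1%:M : 'M[R]_p) = 1%:M.
Proof.
apply/matrixP=> i j; rewrite !mxE -natrM mulnb.
by rewrite -(can_eq (@mxtens_unindexK n p)) -xpair_eqE.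
Qed.

Lemma kron1 d : kron (fun _ : 'I_d => 1%:M : 'M[R]_2) = 1%:M.
Proof. by elim: d => //= d ->; rewrite tensmx1 castmx_sq1. Qed.

Lemma tensmxZ n p (a b : R) (A : 'M[R]_n) (B : 'M[R]_p) :
  (a *: A) *t (b *: B) = (a * b) *: (A *t B).
Proof. by apply/matrixP=> i j; rewrite !mxE mulrACA. Qed.

Lemma kronZ d (a : 'I_d -> R) (A : 'I_d -> 'M[R]_2) :
  kron (fun i => a i *: A i) = (\prod_i a i) *: kron A.
Proof.
elim: d a A => [|d IHd] a A /=; first by rewrite big_ord0 scale1r.
by rewrite IHd tensmxZ castmx_sqZ big_ord_recl.
Qed.

Lemma trmx_matD : (matD R)^T = matD R.
Proof.
by apply/matrixP=> -[[|[|]] //= i] [[|[|]] //= j]; rewrite !mxE.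
Qed.

Lemma trmx_matP : (matP R)^T = matP R.
Proof.
by apply/matrixP=> -[[|[|]] //= i] [[|[|]] //= j]; rewrite !mxE.
Qed.

Lemma matDD : matD R *m matD R = 1%:M.
Proof.
apply/matrixP=> -[[|[|]] //= i] [[|[|]] //= j];
  rewrite !mxE !big_ord_recl big_ord0 !mxE /=; ring.
Qed.

Lemma matPP : matP R *m matP R = 1%:M.
Proof.
apply/matrixP=> -[[|[|]] //= i] [[|[|]] //= j];
  rewrite !mxE !big_ord_recl big_ord0 !mxE /=; ring.
Qed.

Lemma matPD : matP R *m matD R = - (matD R *m matP R).
Proof.
apply/matrixP=> -[[|[|]] //= i] [[|[|]] //= j];
  rewrite !mxE !big_ord_recl !big_ord0 !mxE /=; ring.
Qed.

Local Notation J2 := (matJ2 R).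

Lemma matJ2_00 : J2 0 0 = 1%:M.
Proof. by rewrite /matJ2 mul1mx. Qed.

Lemma matJ2_01 : J2 0 1 = matP R.
Proof. by rewrite /matJ2 mul1mx. Qed.

Lemma matJ2_10 : J2 1 0 = matD R.
Proof. by rewrite /matJ2 mulmx1. Qed.

Lemma matJ2_11 : J2 1 1 = matD R *m matP R.
Proof. by []. Qed.

Definition matJ2E := (matJ2_00, matJ2_01, matJ2_10, matJ2_11).

Lemma matJ2_tr a b : (J2 a b)^T = sgF2 (a * b) *: J2 a b.
Proof.
case: (F2_cases a) => ->; case: (F2_cases b) => ->;
  rewrite ?(mulr0, mul0r, mulr1) matJ2E ?(sgF2_0, sgF2_1) ?scale1r ?scaleN1r.
- exact: trmx1.
- exact: trmx_matP.
- exact: trmx_matD.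
- by rewrite trmx_mul trmx_matP trmx_matD matPD.
Qed.

Lemma matJ2_orth a b : (J2 a b)^T *m J2 a b = 1%:M.
Proof.
case: (F2_cases a) => ->; case: (F2_cases b) => ->; rewrite matJ2E.
- by rewrite trmx1 mulmx1.
- by rewrite trmx_matP matPP.
- by rewrite trmx_matD matDD.
- by rewrite trmx_mul trmx_matP trmx_matD mulmxA -(mulmxA (matP R) (matD R))
    matDD mulmx1 matPP.
Qed.

(** Since [matD] and [matP] anticommute, the sign is governed by the symplectic form of a single
    coordinate plane. *)
Lemma matJ2_comm a b a' b' :
  J2 a b *m J2 a' b' = sgF2 (a * b' - a' * b) *: (J2 a' b' *m J2 a b).
Proof.
case: (F2_cases a) => ->; case: (F2_cases b) => ->;
case: (F2_cases a') => ->; case: (F2_cases b') => ->; rewrite !matJ2E;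
rewrite ?(mulr0, mul0r, mulr1, subrr, subr0, sub0r, sgF2_0, sgF2_1) ?scale1r;
rewrite ?mul1mx ?mulmx1 ?oppr0 ?sgF2_0 ?scale1r //;
apply/matrixP=> -[[|[|]] //= i] [[|[|]] //= j];
rewrite !mxE ?big_ord_recl ?big_ord0 ?mxE ?big_ord_recl ?big_ord0 ?mxE /=.
all: rewrite /sgF2 /=.
all: ring.
Qed.

End Kronecker.

(** * Kronecker products indexed by coordinate vectors *)

Section CoordinateMatrices.

Variables (R : comNzRingType) (m : nat).
Implicit Types a b : 'I_m.+1 -> 'F_2.

(** This is [calJ] in terms of bare coordinates, so that [symplK] can be put in the same form. *)
Definition kronJ a b : 'M[R]_(2 ^ m + 2 ^ m) :=
  castmx (pow2_double m, pow2_double m) (kron (fun i => matJ2 R (a i) (b i))).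

Lemma kronJ_tr a b : (kronJ a b)^T = sgF2 (\sum_i a i * b i) *: kronJ a b.
Proof.
rewrite /kronJ trmx_cast tr_kron -castmx_sqZ sgF2_sum -kronZ; congr castmx.
by apply: eq_kron => i; rewrite matJ2_tr.
Qed.

Lemma kronJ_orth a b : (kronJ a b)^T *m kronJ a b = 1%:M.
Proof.
rewrite /kronJ trmx_cast tr_kron -castmx_sqM kronM.
rewrite (eq_kron (B := fun=> 1%:M)) ?kron1 ?castmx_sq1 // => i.
exact: matJ2_orth.
Qed.

Lemma kronJ_comm a b a' b' :
  kronJ a b *m kronJ a' b' =
  sgF2 (\sum_i (a i * b' i - a' i * b i)) *: (kronJ a' b' *m kronJ a b).
Proof.
rewrite /kronJ -castmx_sqM -[in RHS]castmx_sqM -castmx_sqZ !kronM sgF2_sum.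
rewrite -kronZ; congr castmx.
by apply: eq_kron => i; rewrite matJ2_comm.
Qed.

Definition delta0 (i : 'I_m.+1) : 'F_2 := (i == ord0)%:R.

(** Only the first factor differs from the identity; it is [matD R *m matP R], with rows [(0, 1)]
    and [(-1, 0)]. This explains the linear term of [qform]: it is the commutation sign with
    [symplK]. *)
Lemma kronJ_symplK : kronJ delta0 delta0 = symplK R (2 ^ m).
Proof.
have matDPE (i j : 'I_2) : (matD R *m matP R) i j =
    (if i == 0 :> nat then (j == 1 :> nat)%:R else - (j == 0 :> nat)%:R).
  case: i => [[|[|]] //= i]; case: j => [[|[|]] //= j];
    rewrite !mxE !big_ord_recl big_ord0 !mxE /=; ring.
rewrite /kronJ /= (eq_kron (B := fun=> 1%:M)); last first.
  by move=> i; rewrite /delta0 /= matJ2_00.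
rewrite kron1 /delta0 eqxx matJ2_11.
have n_gt0 : (0 < 2 ^ m)%N by rewrite expn_gt0.
(* The quotient of an index by [2 ^ m] selects the entry of the left factor, the remainder that of
   the right factor. *)
have divS (k : 'I_(2 ^ m)) : ((2 ^ m + k) %/ 2 ^ m = 1)%N.
  by rewrite divnDl // divnn n_gt0 divn_small.
apply/matrixP => i j; rewrite !castmxE [LHS]mxE matDPE /symplK /=.
case: (split_ordP i) => i' ->; case: (split_ordP j) => j' -> /=.
all: rewrite ?block_mxEul ?block_mxEur ?block_mxEdl ?block_mxEdr.
all: rewrite !mxE -?val_eqE /= ?divS ?(divn_small (ltn_ord _)) ?modnDl.
all: rewrite ?(modn_small (ltn_ord _)) /= ?oppr0 ?mul0r ?mul1r ?mulNr ?mul1r //.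
Qed.

End CoordinateMatrices.

(** * The symplectic space [W], its quadratic form and its lines *)

Lemma F2_opp (x : 'F_2) : - x = x.
Proof. by case: (F2_cases x) => ->; apply: val_inj. Qed.

Lemma F2_addxx (x : 'F_2) : x + x = 0.
Proof. by case: (F2_cases x) => ->; apply: val_inj. Qed.

Section SymplecticPlane.

Variables (F : fieldExtType 'F_2) (m : nat).
Variables (e f : m.+1.-tuple (F * F)%type).
Hypothesis hef : is_symplectic_basis e f.

Local Notation W := (F * F)%type.
Implicit Types (u v w : W) (alpha : option F).

Local Notation ca := (coord_a e f).
Local Notation cb := (coord_b e f).
Local Notation q := (qform e f).

Lemma coordsE w : w = \sum_i (ca w i *: tnth e i + cb w i *: tnth f i).
Proof.
have [bas _ _ _] := hef.
rewrite {1}(coord_basis bas (memvf w)) big_split_ord big_split /=.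
congr (_ + _); apply: eq_bigr => i _; congr (_ *: _).
  by rewrite nth_cat size_tuple ltn_ord -tnth_nth.
by rewrite nth_cat size_tuple ltnNge leq_addr /= addKn -tnth_nth.
Qed.

Lemma coord_aD u v i : ca (u + v) i = ca u i + ca v i.
Proof. exact: linearD. Qed.

Lemma coord_bD u v i : cb (u + v) i = cb u i + cb v i.
Proof. exact: linearD. Qed.

Lemma symp_coord u v : symp u v = \sum_i (ca u i * cb v i - ca v i * cb u i).
Proof. by have [_ _ _ symp_sum] := hef; rewrite -symp_sum -!coordsE. Qed.

Lemma sympC u v : symp u v = symp v u.
Proof.
rewrite !symp_coord; apply: eq_bigr => i _.
by rewrite -[LHS]F2_opp opprB.
Qed.

Lemma sympDl u v w : symp (u + v) w = symp u w + symp v w.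
Proof.
rewrite !symp_coord -big_split; apply: eq_bigr => i _ /=.
by rewrite coord_aD coord_bD; ring.
Qed.

Lemma sympDr u v w : symp w (u + v) = symp w u + symp w v.
Proof. by rewrite sympC sympDl !(sympC w). Qed.

Lemma symp0 w : symp 0 w = 0.
Proof. by rewrite -[X in symp X]addr0 sympDl F2_addxx. Qed.

(** A nonzero coordinate of [w] along a basis vector is detected by pairing with the dual basis
    vector. *)
Lemma symp_nondegenerate w : w != 0 -> exists z, symp z w = 1.
Proof.
have [_ _ _ symp_sum] := hef => w_neq0.
have symp_pick a b : symp w (\sum_i (a i *: tnth e i + b i *: tnth f i)) =
    \sum_i (ca w i * b i - a i * cb w i).
  by rewrite [in LHS](coordsE w) symp_sum.
case: (pickP (fun i => ca w i != 0)) => [i ai | ca0].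
  exists (\sum_j (0 *: tnth e j + (j == i)%:R *: tnth f j)).
  rewrite sympC symp_pick (bigD1 i) //= eqxx mulr1 mul0r subr0.
  rewrite big1 ?addr0 => [|j /negPf ->]; last by rewrite mulr0 mul0r subr0.
  by apply/eqP; rewrite -F2_neq0.
case: (pickP (fun i => cb w i != 0)) => [i bi | cb0].
  exists (\sum_j ((j == i)%:R *: tnth e j + 0 *: tnth f j)).
  rewrite sympC symp_pick (bigD1 i) //= eqxx mulr0 mul1r sub0r F2_opp.
  rewrite big1 ?addr0 => [|j /negPf ->]; last by rewrite mulr0 mul0r subr0.
  by apply/eqP; rewrite -F2_neq0.
case/eqP: w_neq0; rewrite (coordsE w) big1 // => i _.
by move/negbFE/eqP: (ca0 i) => ->; move/negbFE/eqP: (cb0 i) => ->;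
  rewrite !scale0r addr0.
Qed.

(** The polar form of [q] is [symp], signs being immaterial over ['F_2]; hence [q] is additive on
    every isotropic line. *)
Lemma qformD u v : q (u + v) = q u + q v + symp u v.
Proof.
rewrite symp_coord /qform !coord_aD !coord_bD.
under eq_bigr do rewrite coord_aD coord_bD.
have -> : \sum_i (ca u i + ca v i) * (cb u i + cb v i) =
    \sum_i ca u i * cb u i + \sum_i ca v i * cb v i +
    \sum_i (ca u i * cb v i - ca v i * cb u i).
  rewrite -!big_split; apply: eq_bigr => i _ /=.
  by rewrite -[- (ca v i * _)]F2_opp opprK; ring.
by ring.
Qed.

Lemma qform0 : q 0 = 0.
Proof. by rewrite -[X in q X]addr0 qformD F2_addxx symp0 add0r. Qed.

Definition on_line alpha w :=
  if alpha is Some al then w.2 == al * w.1 else w.1 == 0.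

Lemma on_lineP alpha w :
  reflect (exists lambda, w = line_pt alpha lambda) (on_line alpha w).
Proof.
case: w => x y; case: alpha => [al|] /=; apply: (iffP eqP) => [-> | [l [-> yl]] //].
- by exists x.
- by exists y.
Qed.

Lemma line_ptD alpha (l l' : F) :
  line_pt alpha (l + l') = line_pt alpha l + line_pt alpha l'.
Proof. by case: alpha => [al|] /=; congr (_, _); rewrite ?mulrDr ?addr0. Qed.

Lemma line_ptI alpha : injective (line_pt alpha).
Proof. by case: alpha => [al|] l l' []. Qed.

Lemma line_pt0 alpha : line_pt alpha 0 = 0.
Proof. by case: alpha => [al|] //=; rewrite mulr0. Qed.

Lemma exists_line w : exists alpha, on_line alpha w.
Proof.
case: (eqVneq w.1 0) => [w0|w0]; first by exists None; rewrite /= w0.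
by exists (Some (w.2 / w.1)); rewrite /= mulfVK.
Qed.

(** Together with [exists_line], this partitions the nonzero vectors by lines, which makes the
    decomposition direct. *)
Lemma on_line_inj alpha beta w :
  w != 0 -> on_line alpha w -> on_line beta w -> alpha = beta.
Proof.
case: w => x y; rewrite -pair_eqE /= negb_and.
case: (eqVneq x 0) => [->|x0] /=; case: alpha => [al|]; case: beta => [be|] //=;
  rewrite ?mulr0 ?(negPf x0) // => y0.
- by rewrite (negPf y0).
- by rewrite (negPf y0).
- by rewrite (negPf y0).
by move=> /eqP-> /eqP/(mulIf x0)->.
Qed.

Lemma field_trace0 : field_trace (0 : F) = 0.
Proof.
have <- : symp (0 : W) 0 = field_trace (0 : F) by rewrite /symp !mul0r subrr.
exact: symp0.
Qed.

Lemma line_isotropic alpha u v :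
  on_line alpha u -> on_line alpha v -> symp u v = 0.
Proof.
move=> /on_lineP[l ->] /on_lineP[l' ->]; rewrite /symp -[RHS]field_trace0.
by congr field_trace; case: alpha => [al|] /=; ring.
Qed.

(** The pairing is the trace of [c * lambda], where [c] measures the failure of the equation of the
    line at [w]. As [c] is invertible, [lambda] can give this product any value, in particular one
    of trace 1. *)
Lemma line_maximal alpha w :
  ~~ on_line alpha w -> exists lambda, symp w (line_pt alpha lambda) = 1.
Proof.
(* Nondegeneracy at [(1, 0)] provides an element [t] of trace 1. *)
have [|z] := @symp_nondegenerate (1, 0).
  by rewrite -pair_eqE /= oner_eq0.
rewrite /symp; set t := (X in field_trace X) => trt.
have solve (c : F) : c != 0 -> exists l, field_trace (c * l) = 1.
  by move=> c0; exists (c^-1 * t); rewrite mulVKf.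
case: w => x y; case: alpha => [al|] /=.
  rewrite eq_sym -subr_eq0 => /solve[l trl]; exists l.
  by rewrite -trl; congr field_trace => /=; ring.
move=> /solve[l trl]; exists l.
by rewrite -trl; congr field_trace => /=; ring.
Qed.

(** * Counting points, and the Gauss sum of the quadratic form *)

Lemma card_finvect : \dim {:F} = m.+1 -> #|{: finvect_type F}| = (2 ^ m.+1)%N.
Proof.
move=> dimF; have := card_vspace (fullv : {vspace finvect_type F}).
by rewrite [\dim _]dimF card_Fp // => <-; apply: eq_card => x; rewrite memvf.
Qed.

Local Notation fW := (finvect_type F * finvect_type F)%type.

Definition coord_pair (w : fW) : {ffun 'I_m.+1 -> 'F_2 * 'F_2} :=
  [ffun i => (ca w i, cb w i)].

Lemma coord_pair_bij : \dim {:F} = m.+1 -> bijective coord_pair.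
Proof.
move=> /card_finvect cardF; apply: inj_card_bij => [u v /ffunP eq_uv|].
  apply: etrans (coordsE u) (etrans _ (esym (coordsE v))).
  by apply: eq_bigr => i _; move: (eq_uv i); rewrite !ffunE => -[-> ->].
by rewrite card_ffun !card_prod !card_ord cardF -expnMn leqnn.
Qed.

(** In coordinates the sum factors over the planes. An ordinary plane contributes
    [1 + 1 + 1 - 1 = 2]; the first one, where the form is [a * b + a + b], contributes
    [1 - 1 - 1 - 1 = -2]. *)
Lemma gauss_sum : \dim {:F} = m.+1 ->
  \sum_(w : fW) sgF2 (q w) = - (2 ^+ m.+1) :> int.
Proof.
move=> /coord_pair_bij bij.
pose t (i : 'I_m.+1) (p : 'F_2 * 'F_2) : 'F_2 :=
  p.1 * p.2 + (if i == ord0 then p.1 + p.2 else 0).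
have qE w : sgF2 (q w) = \prod_i sgF2 (t i (coord_pair w i)) :> int.
  rewrite -sgF2_sum big_split /= -big_mkcond big_pred1_eq; congr sgF2.
  by congr (_ + _); rewrite ?ffunE //; apply: eq_bigr => i _; rewrite ffunE.
transitivity (\sum_(g : {ffun 'I_m.+1 -> 'F_2 * 'F_2})
    \prod_i sgF2 (t i (g i)) : int).
  rewrite (reindex coord_pair); last exact: onW_bij.
  by apply: eq_bigr => w _; rewrite qE.
rewrite -(bigA_distr_bigA (fun i p => sgF2 (t i p))) big_ord_recl /= exprS -mulNr.
congr (_ * _).
  by rewrite -(pair_bigA _ (fun x y => sgF2 (t ord0 (x, y))))
    !big_ord_recl !big_ord0.
rewrite -[in RHS](card_ord m) -prodr_const; apply: eq_bigr => i _.
by rewrite -(pair_bigA _ (fun x y => sgF2 (t (lift ord0 i) (x, y))))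
  !big_ord_recl !big_ord0.
Qed.

(** Translating the parameter by [l0], whose point pairs to 1 with [w], negates every term. *)
Lemma sum_sgF2_line_pt alpha w : ~~ on_line alpha w ->
  \sum_(l : finvect_type F) sgF2 (symp w (line_pt alpha l)) = 0 :> int.
Proof.
move=> /line_maximal[l0 l0E]; set S := (LHS).
have SN : S = - S.
  rewrite {1}/S (reindex_inj (addrI (l0 : finvect_type F))) -sumrN.
  apply: eq_bigr => l _.
  by rewrite line_ptD sympDr sgF2D l0E sgF2_1 mulN1r.
lia.
Qed.

(* If [q] vanished on the line [l], then [q (w + u) = q w + symp w u] for [u] on
   [l], so that [|l|] times the Gauss sum of [q] would be
   [|l|] times the sum of [sgF2 (q w)] over the [w] orthogonal to [l], that is,
   over [l] itself: a nonnegative number. *)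
Lemma qform_line alpha : \dim {:F} = m.+1 ->
  exists lambda, q (line_pt alpha lambda) = 1.
Proof.
move=> dimF.
case: (pickP (fun l : finvect_type F => q (line_pt alpha l) != 0)) => [l|q0].
  by rewrite F2_neq0 => /eqP ql; exists l.
have {}q0 l : q (line_pt alpha l) = 0 by apply/eqP/negbFE/q0.
pose G : int := \sum_(w : fW) sgF2 (q w).
have : (\sum_(l : finvect_type F) G >= 0)%R.
  have -> : \sum_(l : finvect_type F) G =
      \sum_(l : finvect_type F) \sum_(w : fW)
        sgF2 (q w) * sgF2 (symp w (line_pt alpha l)).
    apply: eq_bigr => l _.
    rewrite /G (reindex_inj (addIr (line_pt alpha l : fW))).
    by apply: eq_bigr => w _; rewrite qformD q0 addr0 sgF2D.
  rewrite exchange_big; apply: sumr_ge0 => w _; rewrite -mulr_sumr.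
  have [/on_lineP[l wE] | w_out] := boolP (on_line alpha w); last first.
    by rewrite sum_sgF2_line_pt ?mulr0.
  rewrite [X in q X]wE q0 sgF2_0 mul1r; apply: sumr_ge0 => l' _.
  suff -> : symp w (line_pt alpha l') = 0 by rewrite sgF2_0.
  by apply: (@line_isotropic alpha); apply/on_lineP; [exists l | exists l'].
rewrite sumr_const -[#|_|]/#|{: finvect_type F}| card_finvect //.
rewrite /G gauss_sum // mulNrn oppr_ge0 pmulrn_lle0 ?expn_gt0 //.
by rewrite leNgt exprn_gt0.
Qed.

(** If neither [u] nor [u'] works, each is in the kernel of one of the two linear forms and off the
    kernel of the other, so that [u + u'] works. *)
Lemma line_witness alpha w : \dim {:F} = m.+1 -> ~~ on_line alpha w ->
  exists u, [/\ on_line alpha u, q u = 1 & symp u w = 1].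
Proof.
move=> dimF /line_maximal[l]; set u := line_pt alpha l => wu.
have [l'] := qform_line alpha dimF; set u' := line_pt alpha l' => qu'.
have u_in : on_line alpha u by apply/on_lineP; exists l.
have u'_in : on_line alpha u' by apply/on_lineP; exists l'.
have [qu | qu] := F2_cases (q u); last by exists u; rewrite sympC.
have [wu' | wu'] := F2_cases (symp w u'); last by exists u'; rewrite sympC.
exists (u + u'); split; first by apply/on_lineP; exists (l + l'); rewrite line_ptD.
  by rewrite qformD qu qu' (line_isotropic u_in u'_in) add0r addr0.
by rewrite sympC sympDr wu wu' addr0.
Qed.

End SymplecticPlane.

(** * Spans and submodules *)

Section LinearSpan.

Variables (R : comNzRingType) (V : lmodType R).
Implicit Types (S P : V -> Prop).

Lemma lspan_ind S P : is_submodule P -> (forall x, S x -> P x) ->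
  forall x, lspan S x -> P x.
Proof.
move=> [P0 Plin] SP _ [n [c [v [Sv ->]]]].
elim/big_ind: _ => // [x y Px Py | i _]; first by rewrite -[x]scale1r; apply: Plin.
by rewrite -[_ *: _]addr0; apply: Plin => //; apply: SP.
Qed.

Lemma lspan_submod S : is_submodule (lspan S).
Proof.
split; first by exists 0%N, (fun=> 0), (fun=> 0); split=> [[]|] //; rewrite big_ord0.
move=> a _ _ [n [c [v [Sv ->]]]] [n' [c' [v' [Sv' ->]]]].
exists (n + n')%N.
exists (fun i => match split i with inl j => a * c j | inr j => c' j end).
exists (fun i => match split i with inl j => v j | inr j => v' j end).
split=> [i|]; first by case: (split i).
rewrite big_split_ord scaler_sumr; congr (_ + _); apply: eq_bigr => i _.
  by rewrite (unsplitK (inl i)) scalerA.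
by rewrite (unsplitK (inr i)).
Qed.

Lemma lspan_gen S x : S x -> lspan S x.
Proof.
move=> Sx; exists 1%N, (fun=> 1), (fun=> x); split=> //.
by rewrite big_ord1 scale1r.
Qed.

Lemma submodD P x y : is_submodule P -> P x -> P y -> P (x + y).
Proof. by move=> [_ Plin] Px Py; rewrite -[x]scale1r; apply: Plin. Qed.

Lemma submodZ P a x : is_submodule P -> P x -> P (a *: x).
Proof. by move=> [P0 Plin] Px; rewrite -[_ *: _]addr0; apply: Plin. Qed.

Lemma submod_sum P (I : finType) (x : I -> V) :
  is_submodule P -> (forall i, P (x i)) -> P (\sum_i x i).
Proof.
move=> subP Px; elim/big_ind: _ => //; first exact: subP.1.
by move=> ? ?; apply: submodD.
Qed.

End LinearSpan.

Lemma addF2_eq0 (V : lmodType 'F_2) (u v : V) : (u + v == 0) = (u == v).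
Proof.
have vN : v = - v by rewrite -[v]scale1r -scaleNr F2_opp.
by rewrite {1}vN subr_eq0.
Qed.

(** * The matrices [calJ w] and their coordinate functionals *)

Section SpanningMatrices.

Variables (R : comNzRingType) (F : fieldExtType 'F_2) (m : nat).
Variables (e f : m.+1.-tuple (F * F)%type).
Hypothesis hef : is_symplectic_basis e f.

Local Notation W := (F * F)%type.
Local Notation fW := (finvect_type F * finvect_type F)%type.
Local Notation J := (calJ R e f).
Local Notation K := (symplK R (2 ^ m)).
Local Notation q := (qform e f).
Local Notation q0 w := (\sum_i coord_a e f w i * coord_b e f w i).
Implicit Types (u v w z : W) (alpha : option F).

Lemma calJ_tr w : (J w)^T = sgF2 (q0 w) *: J w.
Proof. exact: kronJ_tr. Qed.

Lemma calJ_orth w : (J w)^T *m J w = 1%:M.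
Proof. exact: kronJ_orth. Qed.

Lemma calJ_orthr w : J w *m (J w)^T = 1%:M.
Proof. by apply: mulmx1C; apply: calJ_orth. Qed.

Lemma calJ_sq w : J w *m J w = sgF2 (q0 w) *: 1%:M.
Proof. by rewrite -(calJ_orth w) calJ_tr -scalemxAl scalerA sgF2K scale1r. Qed.

Lemma calJ_comm u v : J u *m J v = sgF2 (symp u v) *: (J v *m J u).
Proof. by rewrite (symp_coord hef); apply: kronJ_comm. Qed.

(** By [kronJ_symplK] the sign is the pairing of [w] with the vector whose only nonzero coordinates
    are the first of each kind. *)
Lemma symplK_calJ w :
  K *m J w = sgF2 (coord_a e f w ord0 + coord_b e f w ord0) *: (J w *m K).
Proof.
rewrite -kronJ_symplK /calJ -/(kronJ R _ _) kronJ_comm; congr (sgF2 _ *: _).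
rewrite big_ord_recl big1 ?addr0 => [|i _].
  by rewrite /delta0 eqxx mul1r mulr1 addrC F2_opp.
by rewrite /delta0 /= mul0r mulr0 subr0.
Qed.

Lemma calJ_conj z u : J z *m J u *m (J z)^T = sgF2 (symp z u) *: J u.
Proof. by rewrite calJ_comm -scalemxAl -mulmxA calJ_orthr mulmx1. Qed.

(** One factor comes from transposing [J w], the other from moving [K] across it: [q] thus decides
    how [J w] behaves under the involution defining [sp]. *)
Lemma sgF2_qform w :
  sgF2 (q w) = sgF2 (q0 w) *
    sgF2 (coord_a e f w ord0 + coord_b e f w ord0) :> R.
Proof. by rewrite -sgF2D. Qed.

Lemma calJ_sp w : q w = 1 -> J w \in sp_pred R (2 ^ m).
Proof.
move=> qw; rewrite sp_predE calJ_tr -scalemxAr symplK_calJ scalerA -sgF2_qform.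
by rewrite qw sgF2_1 scaleN1r subrr.
Qed.

Variable h : R.
Hypothesis h2 : h *+ 2 = 1.

(** Odd characteristic enters through the inverse [h] of 2. *)
Lemma eq_opp0 (x : R) : x = - x -> x = 0.
Proof.
move=> xN; rewrite -[x]mul1r -h2 mulrnAl -mulrnAr mulr2n {1}xN addNr.
by rewrite mulr0.
Qed.

(** The coordinate along [J w] for the trace form; the power of [h] inverts the matrix size
    [2 ^ m.+1], which is the trace of [J w *m (J w)^T]. *)
Definition calJ_coef w (X : 'M[R]_(2 ^ m + 2 ^ m)) : R :=
  h ^+ m.+1 * \tr (X *m (J w)^T).

Lemma calJ_coefP w a X Y :
  calJ_coef w (a *: X + Y) = a * calJ_coef w X + calJ_coef w Y.
Proof.
by rewrite /calJ_coef mulmxDl mxtraceD -scalemxAl mxtraceZ mulrDr mulrCA.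
Qed.

Lemma calJ_coef0 w : calJ_coef w 0 = 0.
Proof. by rewrite /calJ_coef mul0mx mxtrace0 mulr0. Qed.

Lemma calJ_coefZ w a X : calJ_coef w (a *: X) = a * calJ_coef w X.
Proof. by rewrite -[_ *: _]addr0 calJ_coefP calJ_coef0 addr0. Qed.

Lemma calJ_coef_sum w (I : finType) (X : I -> 'M_(2 ^ m + 2 ^ m)) :
  calJ_coef w (\sum_i X i) = \sum_i calJ_coef w (X i).
Proof.
apply: (big_morph _ _ (calJ_coef0 w)) => A B.
by rewrite -[A]scale1r calJ_coefP mul1r scale1r.
Qed.

(** By cyclicity of the trace, the conjugation moves from [X] to [J w], which it scales by a
    sign. *)
Lemma calJ_coef_conj z w X :
  calJ_coef w (J z *m X *m (J z)^T) = sgF2 (symp z w) * calJ_coef w X.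
Proof.
rewrite /calJ_coef mulrCA; congr (_ * _).
rewrite -mulmxA -trmx_mul calJ_comm linearZ /= trmx_mul -scalemxAr mxtraceZ.
rewrite (sympC hef); congr (_ * _).
by rewrite mxtrace_mulC !mulmxA -(mulmxA _ (J z)^T) calJ_orth mulmx1 mxtrace_mulC.
Qed.

(** Conjugation by [J z] acts on [X] and on [J w] with opposite signs, so the coefficient is its own
    opposite. This serves both for independence and for self-normalization. *)
Lemma calJ_coef_eigen z w s X : J z *m X *m (J z)^T = s *: X ->
  s * sgF2 (symp z w) = -1 -> calJ_coef w X = 0.
Proof.
move=> zX s_zw; apply: eq_opp0.
have := calJ_coef_conj z w X; rewrite zX calJ_coefZ => eqs.
by rewrite -{1}[calJ_coef w X]mul1r -(sgF2K R (symp z w)) -mulrA -eqs mulrA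
  [_ * s]mulrC s_zw mulN1r.
Qed.

Lemma calJ_coef_calJ w v : calJ_coef w (J v) = (w == v)%:R.
Proof.
have [<-|w_v] := eqVneq.
  rewrite /calJ_coef calJ_orthr mxtrace1 -pow2_double natrX -exprMn.
  by rewrite mulr_natr h2 expr1n.
have [|z] := @symp_nondegenerate _ _ _ _ hef (v + w).
  by rewrite addF2_eq0 eq_sym.
rewrite (sympDr hef) => zvw.
by apply: (calJ_coef_eigen (calJ_conj z v)); rewrite -sgF2D zvw.
Qed.

(** For [q w = 0] the matrix [J w *m K] is antisymmetric, while [X *m K] is symmetric; the trace of
    their product is its own opposite. *)
Lemma calJ_coef_sp w X : X \in sp_pred R (2 ^ m) -> q w != 1 -> calJ_coef w X = 0.
Proof.
move=> /sp_symP spX qw.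
have {}qw : q w = 0 by apply/eqP; rewrite -F2_neq0 negbK in qw.
have KJ : K *m (J w)^T = J w *m K.
  by rewrite calJ_tr -scalemxAr symplK_calJ scalerA -sgF2_qform qw scale1r.
have XE : X = - (X *m K *m K) by rewrite -mulmxA symplKK mulmxN mulmx1 opprK.
have tr0 : \tr (X *m K *m K *m (J w)^T) = 0.
  rewrite -mulmxA KJ; apply: eq_opp0.
  rewrite -[LHS]mxtrace_tr trmx_mul spX trmx_mul tr_symplK !mulNmx KJ.
  by rewrite linearN /= mxtrace_mulC.
by rewrite /calJ_coef XE mulNmx linearN /= tr0 oppr0 mulr0.
Qed.

End SpanningMatrices.

(** * The basis of matrices over a finite ring, and the components in coordinates *)

Section FiniteSpan.

Variables (R : finComNzRingType) (F : fieldExtType 'F_2) (m : nat).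
Hypothesis dimF : \dim {:F} = m.+1.
Variables (e f : m.+1.-tuple (F * F)%type).
Hypothesis hef : is_symplectic_basis e f.
Variable h : R.
Hypothesis h2 : h *+ 2 = 1.

Local Notation fW := (finvect_type F * finvect_type F)%type.
Local Notation J := (calJ R e f).
Local Notation q := (qform e f).
Local Notation coef := (calJ_coef e f h).

(** The coefficient functionals make [Phi] injective; the finite sets of coefficient families and of
    matrices have the same cardinality, so [Phi] is bijective. *)
Lemma calJ_span X : X = \sum_(w : fW) coef w X *: J w.
Proof.
pose Phi (c : {ffun fW -> R}) := \sum_(w : fW) c w *: J w.
have PhiK (w : fW) c : coef w (Phi c) = c w.
  rewrite calJ_coef_sum (bigD1 w) //= big1 => [|v v_w];
    rewrite calJ_coefZ (calJ_coef_calJ hef h2).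
    by rewrite eqxx mulr1 addr0.
  by rewrite eq_sym (negPf v_w) mulr0.
have injPhi : injective Phi.
  by move=> c c' eqc; apply/ffunP => w; rewrite -PhiK eqc PhiK.
have [|Psi _ PsiK] := inj_card_bij injPhi.
  rewrite card_mx card_ffun card_prod (card_finvect dimF).
  by rewrite pow2_double.
by rewrite -{1}[X]PsiK; apply: eq_bigr => w _; rewrite -{2}[X]PsiK PhiK.
Qed.

Lemma calJ_coef_inj X Y : (forall w, coef w X = coef w Y) -> X = Y.
Proof.
move=> eqXY; rewrite [X]calJ_span [Y]calJ_span; apply: eq_bigr => w _.
by rewrite eqXY.
Qed.

Lemma H_sl_coef0 alpha X w :
  H_sl e f alpha X -> ~~ on_line alpha w -> coef w X = 0.
Proof.
move=> HX w_out; move: X HX; apply: lspan_ind => [|_ [l [_ ->]]].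
  split=> [|a X Y X0 Y0]; first exact: calJ_coef0.
  by rewrite calJ_coefP X0 Y0 mulr0 addr0.
rewrite (calJ_coef_calJ hef h2) (_ : w == _ = false) //.
by apply: contraNF w_out => /eqP ->; apply/on_lineP; exists l.
Qed.

Lemma H_sp_submod alpha : is_submodule (@H_sp R F m e f alpha).
Proof. exact: lspan_submod. Qed.

Lemma H_sp_calJ alpha w : q w = 1 -> on_line alpha w -> H_sp e f alpha (J w).
Proof.
move=> qw /on_lineP[l wE]; apply: lspan_gen; exists l; split; rewrite -?wE //.
(* The parameter is nonzero because [q] vanishes at 0. *)
apply/eqP=> l0; move: qw; rewrite wE l0 line_pt0 (qform0 hef).
by move/eqP; rewrite eq_sym oner_eq0.
Qed.

Lemma H_sp_sl alpha (X : 'M[R]_(2 ^ m + 2 ^ m)) :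
  H_sp e f alpha X -> H_sl e f alpha X.
Proof.
move: X; apply: lspan_ind => [|_ [l [l0 _ ->]]]; first exact: lspan_submod.
by apply: lspan_gen; exists l.
Qed.

(** In the expansion of [X], the terms off the line vanish by assumption and those with [q w != 1]
    by membership in [sp]; the remaining terms are multiples of generators. *)
Lemma H_spP alpha X :
  H_sp e f alpha X <->
  X \in sp_pred R (2 ^ m) /\ forall w, ~~ on_line alpha w -> coef w X = 0.
Proof.
split=> [HX | [spX X0]].
  split=> [|w w_out].
    move: X HX; apply: lspan_ind => [|_ [l [_ ql ->]]]; last exact: calJ_sp.
    by have [sp0 spP] := sp_submod_closed R (2 ^ m).
  exact: H_sl_coef0 (H_sp_sl HX) w_out.
rewrite [X]calJ_span; apply: submod_sum => [|w]; first exact: H_sp_submod.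
have [w_in | w_out] := boolP (on_line alpha w); last first.
  by rewrite X0 // scale0r; have [] := H_sp_submod alpha.
have [qw | qw] := eqVneq (q w) 1; last first.
  by rewrite (calJ_coef_sp h2 spX qw) scale0r; have [] := H_sp_submod alpha.
by apply: submodZ; [apply: H_sp_submod | apply: H_sp_calJ].
Qed.

Lemma H_sp_comm alpha (X Y : 'M[R]_(2 ^ m + 2 ^ m)) :
  H_sp e f alpha X -> H_sp e f alpha Y -> X *m Y = Y *m X.
Proof.
move=> HX HY; move: X HX; apply: lspan_ind => [|_ [l [_ _ ->]]].
  split=> [|a X X' XY X'Y]; first by rewrite mul0mx mulmx0.
  by rewrite mulmxDl mulmxDr -scalemxAl -scalemxAr XY X'Y.
move: Y HY; apply: lspan_ind => [|_ [l' [_ _ ->]]].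
  split=> [|a Y Y' YX Y'X]; first by rewrite mul0mx mulmx0.
  by rewrite mulmxDl mulmxDr -scalemxAl -scalemxAr YX Y'X.
rewrite (calJ_comm R hef) (line_isotropic hef (alpha := alpha)).
- by rewrite scale1r.
- by apply/on_lineP; exists l.
- by apply/on_lineP; exists l'.
Qed.

(* [J w] squares to a sign [s], so the hypothesis says [2 s X = 2 J w X J w]. *)
Lemma calJ_comm_of_double_comm w X :
  mxcomm X (J w) *m J w = J w *m mxcomm X (J w) -> X *m J w = J w *m X.
Proof.
have := calJ_sq R e f w; set s := sgF2 _ => JJ.
rewrite /mxcomm mulmxBl mulmxBr !mulmxA -(mulmxA X) JJ -scalemxAl -scalemxAr.
rewrite mul1mx mulmx1 => XJ.
have /subr0_eq sXJ : s *: X - J w *m X *m J w = 0.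
  apply/matrixP => i j; rewrite [RHS]mxE; apply: (eq_opp0 h2).
  by rewrite {1}XJ -opprB mxE.
rewrite -[LHS]scale1r -[RHS]scale1r -(sgF2K R _ : s * s = 1) -!scalerA.
congr (_ *: _); rewrite scalemxAl sXJ -(mulmxA _ (J w)) JJ -scalemxAr.
by rewrite mulmx1.
Qed.

End FiniteSpan.

(** * Traces of endomorphisms *)

Section LieTrace.

Variable R : comNzRingType.

Lemma f2mx_linfun (V : vectType R) (f : V -> V) :
  f2mx (linfun f) = lin1_mx (v2r \o f \o r2v).
Proof. by rewrite unlock. Qed.

Lemma eq_lin_trace (V : vectType R) (f g : V -> V) :
  f =1 g -> lin_trace f = lin_trace g.
Proof.
move=> eqfg; rewrite /lin_trace !f2mx_linfun; congr (\tr _).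
by apply/matrixP => i j; rewrite !mxE /= eqfg.
Qed.

Lemma lin_traceP (V : vectType R) a (f g : V -> V) :
  lin_trace (fun x => a *: f x + g x) = a * lin_trace f + lin_trace g.
Proof.
rewrite /lin_trace !f2mx_linfun -mxtraceZ -mxtraceD; congr (\tr _).
by apply/matrixP => i j; rewrite !mxE /= linearP !mxE.
Qed.

(** Matrices act on row vectors, hence the reversed order of the factors. *)
Lemma f2mx_linfun_comp (V : vectType R) (f : {linear V -> V}) (g : V -> V) :
  f2mx (linfun (f \o g)) = f2mx (linfun g) *m f2mx (linfun f).
Proof.
have row_lin1 n (h : 'rV[R]_n -> 'rV[R]_n) i :
    row i (lin1_mx h) = h (delta_mx 0 i) by apply/rowP => j; rewrite !mxE.
rewrite !f2mx_linfun; apply/row_matrixP => i; rewrite row_mul !row_lin1.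
by rewrite (mul_rV_lin1 (v2r \o f \o r2v)) /= v2rK.
Qed.

Lemma lin_traceC (V : vectType R) (f g : {linear V -> V}) :
  lin_trace (f \o g) = lin_trace (g \o f).
Proof. by rewrite /lin_trace f2mx_linfun_comp mxtrace_mulC -f2mx_linfun_comp. Qed.

End LieTrace.

(** * The Killing form and its invariance *)

Section Killing.

Variables (R : comNzRingType) (L : lieVectType R).
Implicit Types x y z : L.

Lemma ad_linear x : linear (ad x).
Proof. by move=> a y z; apply: lieDr. Qed.

HB.instance Definition _ x := GRing.isLinear.Build R L L *:%R (ad x) (ad_linear x).

Lemma killingC x y : killing x y = killing y x.
Proof. exact: lin_traceC. Qed.

Lemma killingPl a x y z :
  killing (a *: x + y) z = a * killing x z + killing y z.
Proof.
by rewrite /killing -lin_traceP; apply: eq_lin_trace => w; rewrite /= /ad lieDl.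
Qed.

Lemma killingZl a x y : killing (a *: x) y = a * killing x y.
Proof.
have k0 : killing 0 y = 0.
  apply: (addrI (killing 0 y)); rewrite -{1}[killing 0 y]mul1r -killingPl.
  by rewrite scaler0 !addr0.
by rewrite -[_ *: _]addr0 killingPl k0 addr0.
Qed.

Lemma killingZr a x y : killing x (a *: y) = a * killing x y.
Proof. by rewrite killingC killingZl killingC. Qed.

(** As [ad (g x)] is the conjugate of [ad x] by [g], cyclicity of the trace gives the equality. *)
Lemma killing_involution (g : {linear L -> L}) x y :
  involutive g -> {morph g : u v / lie u v} -> killing (g x) (g y) = killing x y.
Proof.
move=> gK gM.
have -> : killing (g x) (g y) = lin_trace (g \o (ad x \o ad y \o g)).
  by apply: eq_lin_trace => u; rewrite /= /ad !gM gK.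
by rewrite lin_traceC; apply: eq_lin_trace => u /=; rewrite gK.
Qed.

End Killing.

(** * The decomposition of the symplectic Lie algebra *)

Section SymplecticDecomposition.

Variables (R : finComNzRingType) (F : fieldExtType 'F_2) (m : nat).
Hypothesis dimF : \dim {:F} = m.+1.
Variables (e f : m.+1.-tuple (F * F)%type).
Hypothesis hef : is_symplectic_basis e f.
Variable h : R.
Hypothesis h2 : h *+ 2 = 1.

Local Notation J := (calJ R e f).
Local Notation K := (symplK R (2 ^ m)).
Local Notation q := (qform e f).
Local Notation coef := (calJ_coef e f h).
Local Notation L := (sp R (2 ^ m)).
Local Notation H alpha X := (H_sp e f alpha (sp_val X)).
Implicit Types (X Y : L) (alpha beta : option F).

(** Moving [K] inwards past [J z] or its transpose costs the same sign [s] in both terms of the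
    defining equation, so the equation for [X] factors out. *)
Lemma calJ_conj_sp_subproof z X : J z *m val X *m (J z)^T \in sp_pred R (2 ^ m).
Proof.
set s := sgF2 (coord_a e f z ord0 + coord_b e f z ord0) : R.
have JK : J z *m K = s *: (K *m J z).
  by rewrite symplK_calJ scalerA sgF2K scale1r.
have KJ : (J z)^T *m K = s *: (K *m (J z)^T).
  by rewrite calJ_tr -scalemxAl JK -scalemxAr !scalerA mulrC.
have /eqP spX := valP X.
rewrite sp_predE !trmx_mul trmxK -mulmxA KJ -scalemxAr !mulmxA.
rewrite symplK_calJ -/s -!scalemxAl -scalerDr -mulmxDl -2!mulmxA -mulmxDr spX.
by rewrite mulmx0 mul0mx scaler0.
Qed.

Definition calJ_conj_sp z X : L := Sp (calJ_conj_sp_subproof z X).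

Lemma calJ_conj_sp_linear z : linear (calJ_conj_sp z).
Proof.
move=> a X Y; apply: val_inj => /=.
by rewrite mulmxDr mulmxDl -scalemxAr -scalemxAl.
Qed.

HB.instance Definition _ z :=
  GRing.isLinear.Build R L L *:%R (calJ_conj_sp z) (calJ_conj_sp_linear z).

Lemma calJ_conj_spK z : involutive (calJ_conj_sp z).
Proof.
move=> X; apply: val_inj => /=.
rewrite !mulmxA calJ_sq -mulmxA -trmx_mul calJ_sq linearZ /= trmx1.
by rewrite -scalemxAr mulmx1 -scalemxAl mul1mx scalerA sgF2K scale1r.
Qed.

Lemma calJ_conj_spM z : {morph calJ_conj_sp z : X Y / lie X Y}.
Proof.
move=> X Y; apply: val_inj; rewrite /= /mxcomm.
have JJ A B : J z *m A *m (J z)^T *m (J z *m B *m (J z)^T) =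
    J z *m (A *m B) *m (J z)^T.
  by rewrite !mulmxA -(mulmxA _ (J z)^T) calJ_orth mulmx1.
by rewrite !JJ mulmxBr mulmxBl.
Qed.

Lemma killing_calJ u v (spu : J u \in sp_pred R (2 ^ m))
    (spv : J v \in sp_pred R (2 ^ m)) :
  u != v -> killing (Sp spu) (Sp spv) = 0.
Proof.
(* Conjugation by such a [J z] is a Lie automorphism negating exactly one of [J u] and [J v]. *)
move=> u_v; have [|z] := @symp_nondegenerate _ _ _ _ hef (u + v).
  by rewrite addF2_eq0.
rewrite (sympDr hef) => zuv; apply: (eq_opp0 h2).
have conjE w (spw : J w \in sp_pred R (2 ^ m)) :
    calJ_conj_sp z (Sp spw) = sgF2 (symp z w) *: Sp spw.
  by apply: val_inj; apply: (calJ_conj R hef).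
have := killing_involution (Sp spu) (Sp spv) (calJ_conj_spK z) (@calJ_conj_spM z).
rewrite /= !conjE killingZl killingZr mulrA -sgF2D zuv => {1}<-.
by rewrite mulN1r.
Qed.

Lemma H_sp_killing alpha beta X Y : alpha != beta -> H alpha X -> H beta Y ->
  killing X Y = 0.
Proof.
move=> al_be HX HY.
(* The spans consist of plain matrices, whereas [killing] lives on [sp]; carrying the membership
   proof inside [P] makes [lspan_ind] applicable. *)
pose P Z M := exists spM : M \in sp_pred R (2 ^ m), killing (Sp spM) Z = 0.
have P_submod Z : is_submodule (P Z).
  split.
    exists (valP (0 : L)).
    have -> : Sp (valP (0 : L)) = 0 *: (0 : L) by apply: val_inj; rewrite scale0r.
    by rewrite killingZl mul0r.
  move=> a A B [spA killA] [spB killB].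
  exists (valP (a *: (Sp spA : L) + Sp spB)).
  have -> : Sp (valP (a *: (Sp spA : L) + Sp spB)) = a *: (Sp spA : L) + Sp spB.
    exact: val_inj.
  by rewrite killingPl killA killB mulr0 addr0.
suff [spX killX] : P Y (sp_val X).
  by rewrite -killX; congr killing; apply: val_inj.
move: (sp_val X) HX; apply: lspan_ind => // _ [l [l0 ql ->]].
exists (calJ_sp R ql).
suff [spY killY] : P (Sp (calJ_sp R ql)) (sp_val Y).
  by rewrite killingC -killY; congr killing; apply: val_inj.
move: (sp_val Y) HY; apply: lspan_ind => // _ [l' [l'0 ql' ->]].
exists (calJ_sp R ql'); apply: killing_calJ.
(* Equal nonzero generators would force the two lines to coincide. *)
apply: contraNneq al_be => ll'; apply/eqP.
apply: (@on_line_inj F alpha beta (line_pt alpha l)).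
- rewrite -(line_pt0 alpha); apply: contraNneq l0 => /line_ptI ->; exact: eqxx.
- by apply/on_lineP; exists l.
- by apply/on_lineP; exists l'.
Qed.

Lemma H_sp_self_normalizing alpha X :
  normalizer (fun Y => H alpha Y) X -> H alpha X.
Proof.
move=> normX; apply/(H_spP dimF hef h2); split; first exact: valP.
move=> w /(line_witness hef dimF)[u [u_in qu uw]].
have /= HXu := normX (Sp (calJ_sp R qu)) (H_sp_calJ R hef qu u_in).
(* The bracket of [X] with [J u] stays in the commutative component, so it commutes with [J u]; then
   so does [X]. *)
have comXu := H_sp_comm hef HXu (H_sp_calJ R hef qu u_in).
apply: (calJ_coef_eigen hef h2 (z := u) (s := 1)); last by rewrite mul1r uw.
rewrite -(calJ_comm_of_double_comm h2 comXu) -mulmxA calJ_orthr mulmx1.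
by rewrite scale1r.
Qed.

Lemma H_sp_cartan alpha : is_cartan (fun X => H alpha X) /\
  is_abelian (fun X => H alpha X).
Proof.
have sub : is_submodule (fun X => H alpha X).
  have [H0 HP] := H_sp_submod R e f alpha.
  by split=> [|a X Y HX HY]; [exact: H0 | exact: HP].
have abel : is_abelian (fun X => H alpha X).
  move=> X Y HX HY; apply: val_inj.
  by rewrite /= /mxcomm (H_sp_comm hef HX HY) subrr.
split=> //; split.
- by split=> // X Y HX HY; rewrite abel //; exact: sub.1.
(* Index 1 is the span of the brackets, which all vanish. *)
- exists 1%N => X; apply: (lspan_ind (P := fun X => X = 0)); last first.
    by move=> _ [Y [Z [HY [HZ ->]]]]; apply: abel.
  by split=> // a Y Z -> ->; rewrite scaler0 addr0.
move=> X; split=> [HX Y HY|]; last exact: H_sp_self_normalizing.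
by rewrite abel //; exact: sub.1.
Qed.

Local Notation I := (option (finvect_type F)).

(** A nonzero [w] lies on one line only, so the other components do not contribute. The vector 0
    lies on all lines, but [q 0 = 0] kills its coefficient on [sp]. *)
Lemma coef_sum_lines (y : {ffun I -> L}) w :
  (forall alpha : I, H alpha (y alpha)) ->
  forall alpha : I, on_line alpha w ->
  coef w (sp_val (y alpha)) = coef w (sp_val (\sum_i y i)).
Proof.
move=> Hy alpha w_in.
have [w0 | w0] := eqVneq w 0.
  have qw : q w != 1 by rewrite w0 (qform0 hef) eq_sym oner_eq0.
  by rewrite !(calJ_coef_sp h2 (sp_valP _) qw).
have -> : sp_val (\sum_i y i) = \sum_i sp_val (y i).
  exact: (raddf_sum (val : L -> 'M_(2 ^ m + 2 ^ m))).
rewrite calJ_coef_sum (bigD1 alpha) //= big1 ?addr0 // => beta be_al.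
have [_ ->] := (H_spP dimF hef h2 beta _).1 (Hy beta); first by [].
by apply: contra be_al => w_in'; rewrite (on_line_inj w0 w_in' w_in).
Qed.

Lemma H_sp_direct_sum : is_direct_sum (fun (alpha : I) (X : L) => H alpha X).
Proof.
split=> [alpha|X]; first by have [[[]]] := H_sp_cartan alpha.
have exY (alpha : I) : exists Y : L, H alpha Y /\
    forall w, on_line alpha w -> coef w (sp_val Y) = coef w (sp_val X).
  (* The component of [X] keeps the terms of its expansion carried by the line. *)
  pose M := \sum_(w : finvect_type F * finvect_type F)
    (if on_line alpha w then coef w (sp_val X) else 0) *: J w.
  have HM : H_sp e f alpha M.
    apply: submod_sum => [|w]; first exact: H_sp_submod.
    case: ifP => w_in; last by rewrite scale0r; have [] := H_sp_submod R e f alpha.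
    have [qw | qw] := eqVneq (q w) 1; last first.
      rewrite (calJ_coef_sp h2 (valP X) qw) scale0r.
      by have [] := H_sp_submod R e f alpha.
    by apply: submodZ; [exact: H_sp_submod | exact: H_sp_calJ].
  have [spM _] := (H_spP dimF hef h2 alpha M).1 HM.
  exists (Sp spM); split=> // w w_in /=.
  rewrite calJ_coef_sum (bigD1 (w : finvect_type F * finvect_type F)) //= big1.
    by rewrite w_in calJ_coefZ (calJ_coef_calJ hef h2) eqxx mulr1 addr0.
  move=> v v_w; rewrite calJ_coefZ (calJ_coef_calJ hef h2) eq_sym (negPf v_w).
  by rewrite mulr0.
have [Y0 HY0] := fin_all_exists exY.
pose Y : {ffun I -> L} := [ffun alpha => Y0 alpha].
have HY alpha : H alpha (Y alpha) by rewrite ffunE; case: (HY0 alpha).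
have XE : X = \sum_alpha Y alpha.
  apply: val_inj; apply: (calJ_coef_inj dimF hef h2) => w.
  have [alpha w_in] := exists_line w.
  rewrite -(coef_sum_lines HY w_in) ffunE.
  by have [_ ->] := HY0 alpha.
(* Uniqueness: coefficients on the line are read off from [X], and those off the line are zero. *)
exists Y; split=> // Z [HZ XZ]; apply/ffunP => alpha.
apply: val_inj; apply: (calJ_coef_inj dimF hef h2) => w.
have [w_in | w_out] := boolP (on_line alpha w).
  by rewrite (coef_sum_lines HY w_in) (coef_sum_lines HZ w_in) -XE -XZ.
have [_ ->] := (H_spP dimF hef h2 alpha _).1 (HY alpha); last by [].
by have [_ ->] := (H_spP dimF hef h2 alpha _).1 (HZ alpha).
Qed.

End SymplecticDecomposition.

Theorem theorem3p3 (R : finComNzRingType) (c : nat) (hc : has_char R c)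
    (c_odd : odd c) (m : nat) (m_gt0 : (0 < m)%N)
    (F : fieldExtType 'F_2) (dimF : \dim {:F} = m.+1)
    (e f : m.+1.-tuple (F * F)) (hef : is_symplectic_basis e f) :
  (forall (alpha : option F) (X : 'M[R]_(2 ^ m + 2 ^ m)),
     H_sp e f alpha X <-> H_sl e f alpha X /\ X \in sp_pred R (2 ^ m)) /\
  is_ODAC (fun (alpha : option (finvect_type F)) (X : sp R (2 ^ m)) =>
             H_sp e f alpha (sp_val X)).
Proof.
(* As [c] is odd and zero in [R], [1 + 2 * c./2] vanishes there. *)
pose h : R := - (c./2)%:R.
have h2 : h *+ 2 = 1.
  have /eqP : c%:R == 0 :> R by rewrite hc.
  rewrite -[c in c%:R]odd_double_half c_odd natrD -muln2 natrM mulr_natr => /eqP.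
  by rewrite addr_eq0 /h mulNrn => /eqP.
split=> [alpha X|].
  split=> [HX | [HX spX]].
    by split; [exact: H_sp_sl | have [] := (H_spP dimF hef h2 alpha X).1 HX].
  by apply/(H_spP dimF hef h2); split=> // w; apply: (H_sl_coef0 hef h2).
split.
- exact: (H_sp_direct_sum dimF hef h2).
- exact: (H_sp_cartan dimF hef h2).
- by move=> al be al_be X Y; apply: (H_sp_killing hef h2).
Qed.
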